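(* Let $T_n^1$ and $T_n^2$ be two independent uniform attachment trees with $n$ vertices each, and let $X_n$ be the number of vertices of their largest common (unlabeled) subtree. For every $\varepsilon > 0$ there exists $\delta > 0$ such that, for all sufficiently large $n$, $$\mathbb{P}\left(X_n \leq \varepsilon n\right) \geq \delta .$$
   Context: A uniform attachment tree (random recursive tree) is defined recursively: $T_1$ is a single vertex, and given $T_n$, the tree $T_{n+1}$ is obtained by adding one new vertex and joining it by a single edge to a vertex of $T_n$ chosen uniformly at random, independently of everything else. For two finite trees $T^1,T^2$ (viewed as unlabeled, unrooted graphs), the size of their largest common subtree is the maximum of $|S|$ (number of vertices of $S$) over all trees $S$ such that $S$ is isomorphic to a subtree (connected subgraph) of $T^1$ and to a subtree of $T^2$; $X_n$ is this quantity for $T_n^1$ and $T_n^2$. *)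

(* Defs.v *)
From HB Require Import structures.
From mathcomp Require Import all_boot all_order all_algebra.
From mathcomp Require Import all_classical all_reals all_analysis.

Set Implicit Arguments.
Unset Strict Implicit.
Unset Printing Implicit Defensive.

Import Order.TTheory GRing.Theory Num.Theory.

(* A finite simple graph is a symmetric, irreflexive relation on a finType. *)
Definition simple_graph (V : finType) (e : rel V) : Prop :=
  symmetric e /\ irreflexive e.

Definition connected_graph (V : finType) (e : rel V) : Prop :=
  (0 < #|V|)%N /\ forall x y : V, connect e x y.

(* [x; y] is a ucycle whenever xy is an edge; genuine cycles have length at
   least 3. *)
Definition acyclic_graph (V : finType) (e : rel V) : Prop :=
  forall p : seq V, ucycle e p -> (size p <= 2)%N.

Definition is_tree (V : finType) (e : rel V) : Prop :=
  [/\ simple_graph e, connected_graph e & acyclic_graph e].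

(* The graph with vertex set A and edge relation h; subgraphs need not be
   induced. *)
Definition is_subgraph (V : finType) (e : rel V) (A : {set V}) (h : rel V)
    : Prop :=
  symmetric h /\ forall x y, h x y -> [/\ x \in A, y \in A & e x y].

Definition is_subtree (V : finType) (e : rel V) (A : {set V}) (h : rel V)
    : Prop :=
  [/\ is_subgraph e A h, exists x, x \in A &
      forall x y, x \in A -> y \in A -> connect h x y].

Definition isomorphic_to_subtree (S V : finType) (s : rel S) (e : rel V)
    : Prop :=
  exists (A : {set V}) (h : rel V) (f : S -> V),
    [/\ is_subtree e A h, injective f, f @: [set: S] = A &
        forall x y, s x y = h (f x) (f y)].

Definition has_common_subtree (V1 V2 : finType) (e1 : rel V1) (e2 : rel V2)
    (k : nat) : Prop :=
  exists s : rel 'I_k,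
    [/\ is_tree s, isomorphic_to_subtree s e1 & isomorphic_to_subtree s e2].

(* A common subtree has at most #|V1| vertices, so the range is exhaustive. *)
Definition largest_common_subtree (V1 V2 : finType) (e1 : rel V1)
    (e2 : rel V2) : nat :=
  \max_(k < #|V1|.+1 | `[< has_common_subtree e1 e2 k >]) k.

(* Adds the vertex ord_max, joined exactly to v; the old vertices are embedded
   by lift ord_max, which preserves the underlying integer. *)
Definition attach (n : nat) (e : rel 'I_n) (v : 'I_n) : rel 'I_n.+1 :=
  fun x y =>
    match unlift ord_max x, unlift ord_max y with
    | Some x', Some y' => e x' y'
    | Some x', None => x' == v
    | None, Some y' => y' == v
    | None, None => false
    end.

(* The tree with n.+1 vertices; c k is the vertex of the (k.+1)-vertex tree to
   which the next vertex is attached. *)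
Fixpoint attachment_tree (c : forall k, 'I_k.+1) (n : nat) : rel 'I_n.+1 :=
  if n is m.+1 then attach (@attachment_tree c m) (c m) else fun _ _ => false.

Arguments attachment_tree : clear implicits.

Section Probability.
Local Open Scope classical_set_scope.
Local Open Scope ereal_scope.
Context (d : measure_display) (Omega : measurableType d) (R : realType).
Variable P : probability Omega R.

Definition random_element (F : finType) (X : Omega -> F) : Prop :=
  forall v : F, measurable [set w | X w = v].

Definition uniformly_distributed (F : finType) (X : Omega -> F) : Prop :=
  forall v : F, P [set w | X w = v] = (#|F|%:R^-1)%:E.

Definition mutually_independent (I : eqType) (F : I -> finType)
    (X : forall i, Omega -> F i) : Prop :=
  forall (J : seq I) (A : forall i, {set F i}), uniq J ->
    P [set w | forall i, i \in J -> X i w \in A i] =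
    \prod_(i <- J) P [set w | X i w \in A i].

(* The attachment choices of a pair of independent uniform attachment trees;
   the boolean says which of the two trees is meant. *)
Definition independent_uniform_choices
    (c : bool -> forall k, Omega -> 'I_k.+1) : Prop :=
  [/\ forall b k, random_element (c b k),
      forall b k, uniformly_distributed (c b k) &
      mutually_independent (fun i : bool * nat => c i.1 i.2)].

(* For n >= 1, attachment_tree _ n.-1 is the tree with n vertices. *)
Definition common_subtree_size (c : bool -> forall k, Omega -> 'I_k.+1)
    (n : nat) (w : Omega) : nat :=
  largest_common_subtree (attachment_tree (fun k => c false k w) n.-1)
                         (attachment_tree (fun k => c true k w) n.-1).

End Probability.

(* Main.v *)
Require Import Defs.
From HB Require Import structures.
From mathcomp Require Import all_boot all_order all_algebra.
From mathcomp Require Import all_classical all_reals all_analysis.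
From mathcomp Require Import zify ring.

Set Implicit Arguments.
Unset Strict Implicit.
Unset Printing Implicit Defensive.

Import Order.TTheory GRing.Theory Num.Theory.

(** Fix a large M. With a probability that depends on M only, the first M
    vertices of the first tree form a star and those of the second tree form a
    path. Cut either tree into M blocks, the block of i < M being i together
    with the later vertices whose first ancestor below M is i. As the tree
    grows, the block sizes follow a Polya urn started from M balls of distinct
    colours. If B is the size of a block when there are n vertices, then
    B (B + 1) / (n (n + 1)) is a martingale, so B (B + 1) has mean
    2 n (n + 1) / (M (M + 1)). By Markov's inequality and a union bound over
    the M blocks, all blocks have at most D = n / K vertices with conditional
    probability at least one half once M is large compared with K ^ 2. Here K
    is an integer above 3 / eps, so that 3 D <= eps n.

    When this happens in both trees, no common subtree S has more than 3 D
    vertices. Indeed every edge of the star-like tree cuts off at most D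
    vertices, since on one of its sides there are only vertices of a single
    block. In the path-like tree, the number of vertices of S in the blocks
    0, ..., j grows with j by steps of at most D, so if S has more than 3 D
    vertices, some threshold j leaves more than D of them on each side, and the
    two sides are joined by one edge. Both trees thus give a two-colouring of S
    that changes across this edge and across no other; as S is connected, the
    two colourings agree up to exchanging the colours, which contradicts the
    sizes. See [cuts_eq_or_compl] and [star_path_common_subtree].

    The probabilistic part is exact counting. A history is the list of the
    attachment choices made so far, all histories of a given length are equally
    likely and those of the two trees are independent
    ([prob_history_event]). The moment of B is a sum over the extensions of a
    given initial history ([second_moment], [many_balanced]). *)

(** * Cuts of a connected graph *)

(** The exclusive or of two cuts with the same crossing edges is crossed by no
    edge, hence is constant. *)
Lemma cuts_eq_or_compl (S : finType) (s : rel S) (U W : pred S) :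
  (forall x y, connect s x y) ->
  (forall x y, s x y -> U x (+) U y = W x (+) W y) ->
  U =1 W \/ U =1 predC W.
Proof.
move=> s_conn UW.
have cst x y : U x (+) W x = U y (+) W y.
  have /connectP [p] := s_conn x y.
  elim: p x => [|z p IHp] x /=; first by move=> _ ->.
  case/andP=> /UW Exz path_p /(IHp _ path_p) <-; move: Exz.
  by case: (U x) (U z) (W x) (W z) => [] [] [] [].
case: (pickP (fun _ : S => true)) => [x0 _ | S0]; last by left=> x; have := S0 x.
case E: (U x0 (+) W x0); [right|left] => x; have := cst x x0; rewrite E /=.
  by case: (U x) (W x) => [] [].
by case: (U x) (W x) => [] [].
Qed.

(** Rooted trees on initial segments of nat are given by their parent function;
    the truncation at the root makes 0 its own parent. *)
Section EdgeCut.
Variables (S : finType) (s : rel S) (n : nat) (f : S -> 'I_n) (p : nat -> nat).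
Hypothesis p_lt : forall x, p x <= x.-1.
Hypothesis f_inj : injective f.
Hypothesis f_edge : forall x y, s x y ->
  [/\ 0 < f x & p (f x) = f y] \/ [/\ 0 < f y & p (f y) = f x].

(** Transports a cut of a rooted tree, crossed only by the edge from a to its
    parent, to an embedded graph. The right-hand side mentions the graph alone,
    so that cuts coming from two different embeddings can be compared. *)
Lemma cut_at_edge (C : pred nat) (a : nat) (u v : S) :
  (forall x, 0 < x < n -> C x (+) C (p x) = (x == a)) ->
  f u = a :> nat -> 0 < a -> f v = p a :> nat ->
  forall x y, s x y ->
    C (f x) (+) C (f y) = ((x == u) && (y == v)) || ((x == v) && (y == u)).
Proof.
move=> Ccut fu a_gt0 fv.
have sufchild x y : 0 < f x -> p (f x) = f y ->
    C (f x) (+) C (f y) = ((x == u) && (y == v)) || ((x == v) && (y == u)).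
  move=> fx_gt0 pfx; rewrite -pfx Ccut ?fx_gt0 ?ltn_ord //.
  have -> : (nat_of_ord (f x) == a) = (x == u).
    by rewrite -fu (inj_eq val_inj) (inj_eq f_inj).
  have [xu | neq_xu] /= := eqVneq x u; first subst x.
    have -> : y == v.
      by rewrite -(inj_eq f_inj) -(inj_eq val_inj) /= -pfx fu fv.
    by [].
  apply/esym/negP=> /andP[/eqP xv /eqP yu].
  have := p_lt a; have := p_lt (f x); rewrite pfx xv fv yu fu; lia.
move=> x y /f_edge [[]|[]]; first exact: sufchild.
by move=> fy_gt0 pfy; rewrite addbC sufchild // orbC andbC [X in _ || X]andbC.
Qed.
End EdgeCut.

(** * Blocks around a star and along a path *)

(** col sends each vertex to the root of its block, that is, to its first
    ancestor below M. *)
Section Blocks.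
Variables (M n : nat) (p col : nat -> nat).
Hypothesis p_lt : forall x, p x <= x.-1.
Hypothesis col_small : forall x, x < M -> col x = x.
Hypothesis col_large : forall x, M <= x < n -> col x = col (p x).

Lemma path_threshold_cut j :
  (forall x, x < M -> p x = x.-1) -> j.+1 < M ->
  forall x, 0 < x < n -> (col x < j.+1) (+) (col (p x) < j.+1) = (x == j.+1).
Proof.
move=> p_path ltjM x /andP[x_gt0 ltxn]; have [lt_xM | le_Mx] := ltnP x M.
  rewrite p_path // !col_small; lia.
rewrite (col_large (x := x)) ?le_Mx // addbb; lia.
Qed.

(** W is the set of descendants of a. A descendant of a reaches a before it
    reaches the centre, hence without changing blocks. *)
Lemma star_descendants_cut a :
  (forall x, x < M -> p x = 0) -> 0 < a ->
  exists2 W : pred nat,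
    forall x, 0 < x < n -> W x (+) W (p x) = (x == a) &
    forall x, x < n -> W x -> col x = col a.
Proof.
move=> p_star a_gt0; exists (fun x => asbool (exists m, iter m p x = a)).
  move=> x /andP[x_gt0 _]; have [-> | neq_xa] := eqVneq x a.
    have -> : asbool (exists m, iter m p a = a).
      by apply/asboolP; exists 0.
    apply/negP => /asboolP [m].
    have : iter m p (p a) <= p a.
      by elim: m => //= m IHm; have := p_lt (iter m p (p a)); lia.
    have := p_lt a; lia.
  have -> : asbool (exists m, iter m p (p x) = a)
          = asbool (exists m, iter m p x = a).
    apply/asbool_equiv_eq; split=> [[m E]|[[|m] E]].
    - by exists m.+1; rewrite iterSr.
    - by rewrite -E eqxx in neq_xa.
    - by exists m; rewrite -iterSr.
  by rewrite addbb.
move=> x + /asboolP [m]; elim: m x => [|m IHm] x ltxn; first by move=> /= ->.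
rewrite iterSr; have [lt_xM | le_Mx] := ltnP x M.
  have p0 : p 0 = 0 by have := p_lt 0; lia.
  by rewrite p_star // iter_fix // => a0; rewrite -a0 in a_gt0.
move=> E; rewrite col_large ?le_Mx //; apply: IHm E.
by have := p_lt x; lia.
Qed.
End Blocks.

Lemma card_preim_le (S : finType) n (f : S -> 'I_n) (C : pred 'I_n) :
  injective f -> #|[pred x | C (f x)]| <= #|C|.
Proof.
move=> f_inj; rewrite -(fintype.card_image f_inj); apply: subset_leq_card.
by apply/fintype.subsetP => _ /fintype.imageP [x Cx ->].
Qed.

(** The blocks of the path are crossed in order, so a balanced threshold exists
    and is crossed by one edge; the blocks of the star admit no balanced cut by
    an edge. *)
Lemma star_path_common_subtree (S : finType) (s : rel S) (n M D : nat)
    (f1 f2 : S -> 'I_n) (p1 p2 col1 col2 : nat -> nat) :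
  (forall x y, connect s x y) ->
  injective f1 -> injective f2 ->
  (forall x y, s x y ->
    [/\ 0 < f1 x & p1 (f1 x) = f1 y] \/ [/\ 0 < f1 y & p1 (f1 y) = f1 x]) ->
  (forall x y, s x y ->
    [/\ 0 < f2 x & p2 (f2 x) = f2 y] \/ [/\ 0 < f2 y & p2 (f2 y) = f2 x]) ->
  (forall x, p1 x <= x.-1) -> (forall x, p2 x <= x.-1) ->
  (forall x, x < M -> p1 x = 0) -> (forall x, x < M -> p2 x = x.-1) ->
  (forall x, x < M -> col1 x = x) -> (forall x, x < M -> col2 x = x) ->
  (forall x, M <= x < n -> col1 x = col1 (p1 x)) ->
  (forall x, M <= x < n -> col2 x = col2 (p2 x)) ->
  (forall x, x < n -> col2 x < M) ->
  (forall i, #|[pred v : 'I_n | col1 v == i]| <= D) ->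
  (forall i, #|[pred v : 'I_n | col2 v == i]| <= D) ->
  #|S| <= 3 * D.
Proof.
move=> s_conn f1_inj f2_inj edge1 edge2 p1_lt p2_lt star1 path2.
move=> small1 small2 large1 large2 col2_lt block1 block2.
rewrite leqNgt; apply/negP => S_big.
pose L j := [pred x | col2 (f2 x) < j].
have L_step j : #|L j.+1| <= #|L j| + D.
  pose Q := [pred x | col2 (f2 x) == j].
  have Q_le : #|Q| <= D.
    have := block2 j; apply: leq_trans.
    exact: (card_preim_le [pred v : 'I_n | col2 v == j] f2_inj).
  have LQ : #|L j.+1| <= #|[predU L j & Q]|.
    by apply: subset_leq_card; apply/fintype.subsetP=> x; rewrite !inE ltnS; lia.
  apply: leq_trans LQ _.
  by rewrite (leq_trans (leq_addr #|[predI L j & Q]| _)) // cardUI leq_add2l.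
have L_all : #|L M| = #|S|.
  by apply: eq_card => x; rewrite !inE col2_lt.
(* The first threshold with more than D vertices below it has at most 2 D of
   them, which leaves more than D above. *)
have [j [D_lt j_le]] : exists j, D < #|L j.+1| /\ #|L j| <= D.
  have L0 : #|L 0| <= D by rewrite eq_card0.
  have: D < #|L M| by lia.
  elim: (M) => [|j IHj]; first by lia.
  by case: (leqP #|L j| D) => [le_jD lt_Dj|/IHj //]; exists j.
have sum_card : #|L j.+1| + #|[predC L j.+1]| = #|S| by rewrite cardC.
have C_big : D < #|[predC L j.+1]|.
  by have := leq_trans (L_step j) (leq_add j_le (leqnn D)); lia.
have [x0 Lx0] : exists x, x \in L j.+1.
  by apply/card_gt0P; exact: leq_ltn_trans D_lt.
have [y0 Cy0] : exists x, x \in [predC L j.+1].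
  by apply/card_gt0P; exact: leq_ltn_trans C_big.
have lt_jM : j.+1 < M.
  by have := col2_lt (f2 y0) (ltn_ord _); move: Cy0; rewrite !inE; lia.
have thr : forall x, 0 < x < n ->
    (col2 x < j.+1) (+) (col2 (p2 x) < j.+1) = (x == j.+1).
  exact: (path_threshold_cut small2 large2 path2).
(* Connectedness provides an edge across the threshold, and it must be the
   edge of the path from j.+1 to j. *)
have [u [v [suv fu fv]]] : exists u v,
    [/\ s u v \/ s v u, f2 u = j.+1 :> nat & f2 v = p2 j.+1 :> nat].
  have /connectP [q] := s_conn x0 y0.
  elim: q x0 Lx0 => [|z q IHq] x Lx /=.
    by move=> _ E; move: Cy0; rewrite E !inE in Lx *; rewrite Lx.
  case/andP=> sxz path_q last_q.
  have [Lz|Cz] := boolP (z \in L j.+1); first exact: IHq Lz path_q last_q.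
  rewrite !inE in Lx Cz.
  case: (edge2 _ _ sxz) => [[gt0 E]|[gt0 E]].
    have := thr (f2 x); rewrite gt0 ltn_ord => /(_ isT).
    rewrite E Lx (negbTE Cz) /= => /esym/eqP fx.
    by exists x, z; rewrite -E fx; split=> //; left.
  have := thr (f2 z); rewrite gt0 ltn_ord => /(_ isT).
  rewrite E Lx (negbTE Cz) /= => /esym/eqP fz.
  by exists z, x; rewrite -E fz; split=> //; right.
have cutL := cut_at_edge p2_lt f2_inj edge2 thr fu isT fv.
(* The same edge, seen in the star-like tree, cuts off few vertices. *)
have [W cutW W_small] : exists2 W : pred S,
    forall x y, s x y ->
      W x (+) W y = ((x == u) && (y == v)) || ((x == v) && (y == u)) &
    #|W| <= D.
  have: [/\ 0 < f1 u & p1 (f1 u) = f1 v] \/ [/\ 0 < f1 v & p1 (f1 v) = f1 u].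
    by case: suv => /edge1 []; [left|right|right|left].
  have branch a b : 0 < f1 a -> p1 (f1 a) = f1 b -> exists2 W : pred S,
    forall x y, s x y ->
      W x (+) W y = ((x == a) && (y == b)) || ((x == b) && (y == a)) &
    #|W| <= D.
    move=> a_gt0 pa.
    have [W cutW colW] := star_descendants_cut p1_lt large1 star1 a_gt0.
    exists (fun x => W (f1 x)).
      by apply: (cut_at_edge p1_lt f1_inj edge1 cutW); rewrite // pa.
    apply: leq_trans (block1 (col1 (f1 a))).
    apply: leq_trans (card_preim_le (fun v : 'I_n => W v) f1_inj) _.
    apply: subset_leq_card; apply/fintype.subsetP => x Wx.
    by rewrite inE; apply/eqP; apply: colW Wx.
  case=> [[] /branch + /[dup] _|[] /branch + /[dup] _] => /[apply] //.
  by case=> W cutW ?; exists W => // x y /cutW ->; rewrite orbC.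
have [] := @cuts_eq_or_compl _ s (L j.+1) W s_conn.
- by move=> x y sxy; rewrite cutW // -cutL.
- by move/eq_card => E; move: D_lt; rewrite E ltnNge W_small.
- move=> LW; have : #|[predC L j.+1]| = #|W|.
    apply: eq_card => x; rewrite !inE.
    by have := LW x; rewrite /= => ->; rewrite negbK.
  by move=> E; move: C_big; rewrite E ltnNge W_small.
Qed.
(** * Attachment histories *)

(** A history lists the attachment choices: its j-th entry is the vertex to
    which vertex j.+1 is attached. *)
Definition parent (h : seq nat) (x : nat) : nat := nth 0 h x.-1.

Definition attachment_seq (h : seq nat) : Prop :=
  forall j, j < size h -> nth 0 h j <= j.

Lemma parent_le h : attachment_seq h -> forall x, parent h x <= x.-1.
Proof.
move=> h_ok x; rewrite /parent; case: (ltnP x.-1 (size h)) => [/h_ok //|le].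
by rewrite nth_default.
Qed.

(** Roots of the blocks of all vertices, when M vertices are followed by others
    that are attached according to t. They are the same for every tree on the
    first M vertices, so one urn describes both the star and the path. *)
Definition blocks (M : nat) (t : seq nat) : seq nat :=
  foldl (fun cols v => rcons cols (nth 0 cols v)) (iota 0 M) t.

Lemma blocks_rcons M t v :
  blocks M (rcons t v) = rcons (blocks M t) (nth 0 (blocks M t) v).
Proof. by rewrite /blocks -cats1 foldl_cat. Qed.

Lemma size_blocks M t : size (blocks M t) = M + size t.
Proof.
elim/last_ind: t => [|t v IHt]; first by rewrite size_iota addn0.
by rewrite blocks_rcons !size_rcons IHt addnS.
Qed.

Lemma nth_blocks_lt M t x : 0 < M -> nth 0 (blocks M t) x < M.
Proof.
move=> M_gt0; elim/last_ind: t x => [|t v IHt] x.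
  have [lt_xM|le_Mx] := ltnP x M; first by rewrite nth_iota.
  by rewrite nth_default // size_iota.
by rewrite blocks_rcons nth_rcons; do 2?case: ifP => // _.
Qed.

Lemma nth_blocks_root M t x : x < M -> nth 0 (blocks M t) x = x.
Proof.
move=> lt_xM; elim/last_ind: t => [|t v IHt]; first by rewrite nth_iota.
by rewrite blocks_rcons nth_rcons size_blocks ltn_addr.
Qed.

Lemma nth_blocks_parent base t x :
  attachment_seq (base ++ t) ->
  size base < x <= size (base ++ t) ->
  nth 0 (blocks (size base).+1 t) x =
  nth 0 (blocks (size base).+1 t) (parent (base ++ t) x).
Proof.
elim/last_ind: t x => [|t v IHt] x; first by rewrite cats0; lia.
rewrite -rcons_cat => h_ok; rewrite size_rcons => /andP[lt_bx le_x].
have h_ok' : attachment_seq (base ++ t).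
  move=> j lt_j; have := h_ok j; rewrite size_rcons nth_rcons lt_j; apply.
  exact: ltnW.
have p_lt := parent_le h_ok x.
have E : nth 0 (blocks (size base).+1 (rcons t v)) (parent (rcons (base ++ t) v) x)
       = nth 0 (blocks (size base).+1 t) (parent (rcons (base ++ t) v) x).
  by rewrite blocks_rcons nth_rcons size_blocks addSn -size_cat; case: ltnP => //; lia.
rewrite E blocks_rcons nth_rcons size_blocks addSn -size_cat ltnS.
rewrite /parent nth_rcons.
have [le_xb|lt_bx'] := leqP x (size (base ++ t)).
  by rewrite IHt ?lt_bx //= ifT //; lia.
have -> : x = (size (base ++ t)).+1 by lia.
by rewrite eqxx ltnn eqxx.
Qed.

Lemma card_block k (cs : seq nat) i :
  size cs = k -> #|[pred v : 'I_k | nth 0 cs v == i]| = count_mem i cs.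
Proof.
move=> <-; rewrite -sum1_count (big_nth 0) big_mkord -sum1_card.
exact: eq_bigl.
Qed.

Definition balanced (M D : nat) (t : seq nat) : bool :=
  all (fun i => count_mem i (blocks M t) <= D) (iota 0 M).

Lemma card_balanced_block M D t k i : 0 < M -> size t + M = k ->
  balanced M D t -> #|[pred v : 'I_k | nth 0 (blocks M t) v == i]| <= D.
Proof.
move=> M_gt0 sz /allP bal; have [lt_iM|le_Mi] := ltnP i M.
  by rewrite card_block ?size_blocks -?sz 1?addnC //; apply: bal; rewrite mem_iota.
rewrite eq_card0 // => v; rewrite !inE; apply/negbTE.
by have := nth_blocks_lt t v M_gt0; lia.
Qed.

Lemma attachment_tree_edge c k (x y : 'I_k.+1) : attachment_tree c k x y ->
  (exists2 j : nat, j < k & x = j.+1 :> nat /\ y = c j :> nat) \/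
  (exists2 j : nat, j < k & y = j.+1 :> nat /\ x = c j :> nat).
Proof.
elim: k x y => [//|k IHk] x y /=; rewrite /attach.
case: unliftP => [x'|] ->; case: unliftP => [y'|] -> //; rewrite ?lift_max.
- by case/IHk=> [] [j lt_jk Exy]; [left|right]; exists j => //; apply: leqW.
- by move/eqP=> ->; right; exists k.
- by move/eqP=> ->; left; exists k.
Qed.

Lemma eq_attachment_tree c c' k :
  (forall j, j < k -> c j = c' j) -> attachment_tree c k = attachment_tree c' k.
Proof.
by elim: k => //= k IHk eq_c; rewrite IHk ?eq_c // => j /ltnW; apply: eq_c.
Qed.

Definition choices_of (h : seq nat) : forall k, 'I_k.+1 :=
  fun k => inord (nth 0 h k).

Lemma choices_of_edge h k (x y : 'I_k.+1) :
  attachment_seq h -> size h = k -> attachment_tree (choices_of h) k x y ->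
  [/\ 0 < x & parent h x = y] \/ [/\ 0 < y & parent h y = x].
Proof.
move=> h_ok size_h; subst k.
case/attachment_tree_edge=> [] [j lt_j [Ex Ey]]; [left|right];
  by rewrite Ey Ex /parent /choices_of inordK ?ltnS ?h_ok.
Qed.

Lemma star_path_largest_common_subtree m D k t1 t2 :
  let star := nseq m 0 in let path := iota 0 m in
  attachment_seq (star ++ t1) -> attachment_seq (path ++ t2) ->
  size (star ++ t1) = k -> size (path ++ t2) = k ->
  balanced m.+1 D t1 -> balanced m.+1 D t2 ->
  largest_common_subtree (attachment_tree (choices_of (star ++ t1)) k)
    (attachment_tree (choices_of (path ++ t2)) k) <= 3 * D.
Proof.
move=> star path ok1 ok2 sz1 sz2 bal1 bal2.
have szs : size star = m by rewrite size_nseq.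
have szp : size path = m by rewrite size_iota.
rewrite /largest_common_subtree; apply/bigmax_leqP => l /asboolP [s [s_tree]].
case=> [A1 [g1 [f1 [[[_ sub1] _ _] inj1 _ hom1]]]].
case=> [A2 [g2 [f2 [[[_ sub2] _ _] inj2 _ hom2]]]].
case: s_tree => _ [_ s_conn] _.
rewrite -[X in X <= _](card_ord l).
apply: (@star_path_common_subtree _ s k.+1 m.+1 D f1 f2 (parent (star ++ t1))
  (parent (path ++ t2)) (nth 0 (blocks m.+1 t1)) (nth 0 (blocks m.+1 t2))) => //.
- by move=> x y; rewrite hom1 => /sub1 [_ _ /choices_of_edge]; apply.
- by move=> x y; rewrite hom2 => /sub2 [_ _ /choices_of_edge]; apply.
- exact: parent_le.
- exact: parent_le.
- move=> x lt_x; rewrite /parent nth_cat szs; case: ltnP => [_|le].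
    by rewrite nth_nseq if_same.
  have m0 : m = 0 by lia.
  have := parent_le ok1 x; rewrite /parent nth_cat szs ltnNge le /=; lia.
- move=> x lt_x; rewrite /parent nth_cat szp; case: ltnP => [lt|le].
    by rewrite nth_iota.
  have m0 : m = 0 by lia.
  have := parent_le ok2 x; rewrite /parent nth_cat szp ltnNge le /=; lia.
- by move=> x; apply: nth_blocks_root.
- by move=> x; apply: nth_blocks_root.
- by move=> x x_bd; have := @nth_blocks_parent star t1 x; rewrite szs sz1; apply.
- by move=> x x_bd; have := @nth_blocks_parent path t2 x; rewrite szp sz2; apply.
- by move=> x _; apply: nth_blocks_lt.
- by move=> i; apply: card_balanced_block => //; rewrite -sz1 size_cat szs; lia.
- by move=> i; apply: card_balanced_block => //; rewrite -sz2 size_cat szp; lia.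
Qed.

(** * The urn of block sizes *)

(** Lists each way of attaching m vertices to M earlier ones exactly once, so
    that expectations become sums over a list. *)
Fixpoint extensions (M m : nat) : seq (seq nat) :=
  if m is m'.+1 then
    [seq rcons t v | t <- extensions M m', v <- iota 0 (M + m')]
  else [:: [::]].

Lemma extensionsS M m : extensions M m.+1 =
  [seq rcons t v | t <- extensions M m, v <- iota 0 (M + m)].
Proof. by []. Qed.

Lemma sum_extensions M m (F : seq nat -> nat) :
  \sum_(t <- extensions M m.+1) F t =
  \sum_(t <- extensions M m) \sum_(0 <= v < M + m) F (rcons t v).
Proof. by rewrite extensionsS big_allpairs_dep /index_iota subn0. Qed.

Lemma extensionsP M m t : t \in extensions M m ->
  size t = m /\ forall j, j < m -> nth 0 t j < M + j.
Proof.
elim: m t => [|m IHm] t; first by rewrite inE => /eqP ->.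
rewrite extensionsS; case/allpairsP => -[u v] [/= /IHm [sz_u u_ok] + ->].
rewrite mem_iota => v_lt.
split=> [|j]; first by rewrite size_rcons sz_u.
rewrite ltnS leq_eqVlt nth_rcons sz_u; case: ltngtP => // [/u_ok //|-> _].
by move: v_lt; rewrite add0n.
Qed.

Lemma extensions_uniq M m : uniq (extensions M m).
Proof.
elim: m => // m IHm; rewrite extensionsS; apply: allpairs_uniq => //.
  exact: iota_uniq.
by move=> [t v] [t' v'] _ _ /= /rcons_inj [-> ->].
Qed.

Lemma size_extensions M m : M`! * size (extensions M.+1 m) = (M + m)`!.
Proof.
elim: m => [|m IHm]; first by rewrite addn0 muln1.
by rewrite extensionsS size_allpairs size_iota mulnA IHm addnS factS addSn mulnC.
Qed.

(** Among the choices of the next vertex, b of them raise b (b + 1) to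
    (b + 1) (b + 2), and the others keep it: the total is b (b + 1) times
    the number of choices plus 2. *)
Lemma urn_step (s : seq nat) i :
  \sum_(0 <= v < size s)
     count_mem i (rcons s (nth 0 s v)) * (count_mem i (rcons s (nth 0 s v))).+1
  = count_mem i s * (count_mem i s).+1 * (size s).+2.
Proof.
rewrite -(big_nth 0 predT (fun c =>
   count_mem i (rcons s c) * (count_mem i (rcons s c)).+1)).
set b := count_mem i s.
under eq_bigr do rewrite -cats1 count_cat /= addn0 -/b.
rewrite (bigID (pred1 i)) /=.
under eq_bigr => c /eqP -> do rewrite eqxx.
rewrite [X in _ + X](eq_bigr (fun=> b * b.+1)); last first.
  by move=> c /negbTE ->; rewrite addn0.
rewrite !big_const_seq !iter_addn_0.
have -> : count (fun c => c != i) s = size s - b.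
  by rewrite -(count_predC (pred1 i) s) /b addKn.
have : b <= size s by apply: count_size.
rewrite -/b; nia.
Qed.

(** B (B + 1) / (n (n + 1)) is a martingale started at 2 / (M (M + 1)). *)
Lemma second_moment M m i : 0 < M -> i < M ->
  (\sum_(t <- extensions M m)
      count_mem i (blocks M t) * (count_mem i (blocks M t)).+1) * (M * M.+1)
  = 2 * ((M + m) * (M + m).+1) * size (extensions M m).
Proof.
move=> M_gt0 lt_iM; elim: m => [|m IHm].
  rewrite big_seq1 /blocks /= count_uniq_mem ?iota_uniq // mem_iota lt_iM addn0; lia.
rewrite sum_extensions extensionsS size_allpairs size_iota big_seq.
under eq_bigr => t /extensionsP [sz_t _].
  under eq_bigr do rewrite blocks_rcons.
  rewrite -[X in index_iota _ (M + X)]sz_t -size_blocks urn_step size_blocks sz_t.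
  over.
rewrite -big_seq -big_distrl /= mulnAC IHm; lia.
Qed.

(** Markov's inequality for B (B + 1) and a union bound over the M blocks. *)
Lemma many_balanced M D m : 0 < M ->
  4 * ((M + m) * (M + m).+1) <= M.+1 * (D.+1 * D.+1) ->
  size (extensions M m) <= 2 * count (balanced M D) (extensions M m).
Proof.
move=> M_gt0 D_big.
pose B i t := count_mem i (blocks M t).
have markov : count (predC (balanced M D)) (extensions M m) * (D.+1 * D.+1) <=
    \sum_(t <- extensions M m) \sum_(0 <= i < M) B i t * (B i t).+1.
  rewrite -sum1_count big_distrl /= big_mkcond /=; apply: leq_sum => t _.
  case: ifPn => //= /allPn [i]; rewrite mem_iota => lt_iM; rewrite -ltnNge => ltD.
  rewrite mul1n (bigD1_seq i) ?iota_uniq ?mem_index_iota //=.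
  by rewrite (leq_trans _ (leq_addr _ _)) // leq_mul // ltnW.
move: markov; rewrite exchange_big /= -(count_predC (balanced M D)).
set c' := count (predC _) _; set c := count _ _ => markov.
have : c' * (D.+1 * D.+1) * (M * M.+1) <=
    M * (2 * ((M + m) * (M + m).+1) * (c + c')).
  apply: leq_trans (leq_mul markov (leqnn _)) _.
  rewrite big_distrl /= big_nat.
  under eq_bigr => i lt_i do rewrite second_moment // -(count_predC (balanced M D)).
  by rewrite -big_nat sum_nat_const_nat subn0.
set E := D.+1 * D.+1 in D_big *; set N := (M + m) * _ in D_big *.
(* With E = (D + 1) ^ 2 and N = n (n + 1), the bound reads
   c' E (M + 1) <= 2 N (c + c') after division by M. *)
rewrite mulnCA leq_pmul2l //.
have N_gt0 : 0 < N by rewrite /N; lia.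
clearbody c c' E N; clear -N_gt0 D_big.
move=> H; have H2 : c' * (4 * N) <= 2 * N * (c + c').
  apply: leq_trans H; rewrite -mulnA [E * _]mulnC leq_mul2l D_big orbT //.
rewrite leqNgt; apply/negP => lt; have := leq_mul (leqnn N) lt; nia.
Qed.

(** * Probabilities of histories *)

Lemma attachment_seq_cat base t m :
  attachment_seq base -> t \in extensions (size base).+1 m ->
  attachment_seq (base ++ t).
Proof.
move=> base_ok /extensionsP [sz_t t_ok] j; rewrite size_cat nth_cat sz_t => lt_j.
case: ltnP => [/base_ok //|le_j].
by have := t_ok (j - size base); lia.
Qed.

Local Open Scope classical_set_scope.
Local Open Scope ring_scope.

Section History.
Context (R : realType) (d : measure_display) (Omega : measurableType d).
Variables (P : probability Omega R) (c : bool -> forall k : nat, Omega -> 'I_k.+1).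
Hypothesis hc : independent_uniform_choices P c.

Definition history (b : bool) (k : nat) (w : Omega) : seq nat :=
  mkseq (fun j => c b j w : nat) k.

Definition history_event (k : nat) (h : seq nat * seq nat) : set Omega :=
  [set w | history false k w = h.1 /\ history true k w = h.2].

Lemma choice_event b j v : (v <= j)%N ->
  [set w | c b j w = v :> nat] = [set w | c b j w = inord v].
Proof.
move=> le_vj; apply/seteqP; split=> w /= => [E|->]; last by rewrite inordK.
by apply: val_inj; rewrite /= inordK.
Qed.

Lemma measurable_choice b j v : measurable [set w | c b j w = v :> nat].
Proof.
case: hc => c_meas _ _; have [le_vj|lt_jv] := leqP v j.
  by rewrite choice_event //; apply: c_meas.
rewrite [X in measurable X](_ : _ = set0) //; apply/seteqP; split=> w //= E.
by have := ltn_ord (c b j w); rewrite E ltnS leqNgt lt_jv.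
Qed.

Lemma measurable_history b k h : measurable [set w | history b k w = h].
Proof.
elim/last_ind: h k => [|h v IHh] [|k].
- rewrite [X in measurable X](_ : _ = setT) //.
  exact/seteqP.
- rewrite [X in measurable X](_ : _ = set0) //.
  by apply/seteqP; split=> w //= /(congr1 size); rewrite size_mkseq.
- rewrite [X in measurable X](_ : _ = set0) //.
  by apply/seteqP; split=> w //= /(congr1 size); rewrite size_rcons.
rewrite [X in measurable X](_ : _ =
  [set w | history b k w = h] `&` [set w | c b k w = v :> nat]).
  by apply: measurableI => //; apply: measurable_choice.
have hS w : history b k.+1 w = rcons (history b k w) (c b k w).
  by rewrite /history mkseqS.
apply/seteqP; split=> w /=; rewrite hS; last by case=> -> ->.
by case/rcons_inj.
Qed.

Lemma measurable_history_event k h : measurable (history_event k h).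
Proof. by apply: measurableI; apply: measurable_history. Qed.

Lemma prob_history_event k h1 h2 :
  attachment_seq h1 -> attachment_seq h2 -> size h1 = k -> size h2 = k ->
  P (history_event k (h1, h2)) = ((k`!%:R ^- 1 * k`!%:R ^- 1 : R)%:E).
Proof.
move=> ok1 ok2 sz1 sz2; case: hc => _ c_unif c_indep.
pose J := [seq (false, j) | j <- iota 0 k] ++ [seq (true, j) | j <- iota 0 k].
pose hh (b : bool) := if b then h2 else h1.
pose A (i : bool * nat) : {set 'I_i.2.+1} :=
  finset (fun x : 'I_i.2.+1 => x == nth 0%N (hh i.1) i.2 :> nat).
have J_uniq : uniq J.
  rewrite cat_uniq !map_inj_uniq ?iota_uniq /= ?andbT; last 2 first.
  - by move=> i j [].
  - by move=> i j [].
  by apply/hasPn => _ /mapP [j _ ->]; apply/mapP => -[].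
have -> : history_event k (h1, h2) =
    [set w | forall i, i \in J -> c i.1 i.2 w \in A i].
  apply/seteqP; split=> w /=.
    case=> /= E1 E2 [b j]; rewrite mem_cat => /orP [] /mapP [l];
    rewrite mem_iota => /andP[_ ltlk] [-> ->]; rewrite inE /=.
      by rewrite -E1 nth_mkseq.
    by rewrite -E2 nth_mkseq.
  move=> H; split=> /=; apply: (@eq_from_nth _ 0%N); rewrite size_mkseq // => j ltjk.
    have := H (false, j); rewrite mem_cat map_f ?mem_iota //= => /(_ isT).
    by rewrite inE nth_mkseq // => /eqP.
  have := H (true, j); rewrite mem_cat orbC map_f ?mem_iota //= => /(_ isT).
  by rewrite inE nth_mkseq // => /eqP.
rewrite c_indep //.
have factor b j : (j < k)%N ->
    P [set w | c b j w \in A (b, j)] = ((j.+1%:R ^-1 : R)%:E).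
  move=> ltjk; have le_j : (nth 0%N (hh b) j <= j)%N.
    by case: b; [apply: ok2; rewrite sz2|apply: ok1; rewrite sz1].
  rewrite -[in RHS](card_ord j.+1) -(c_unif b j (inord (nth 0%N (hh b) j))).
  rewrite -choice_event //; congr (P _); apply/seteqP.
  by split=> w /=; rewrite inE => /eqP.
have prod_fact b : (\prod_(j <- iota 0 k) P [set w | c b j w \in A (b, j)])%E =
    ((k`!%:R ^-1 : R)%:E).
  rewrite big_seq; under eq_bigr => j.
    rewrite mem_iota => /andP[_ ltjk]; rewrite factor //; over.
  rewrite -big_seq prodEFin; congr (_%:E).
  elim: (k) => [|l IHl]; first by rewrite big_nil invr1.
  by rewrite -addn1 iotaD big_cat /= big_seq1 IHl add0n addn1 factS natrM invfM mulrC.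
by rewrite big_cat !big_map /= !prod_fact EFinM.
Qed.

Lemma prob_history_events k (L : seq (seq nat * seq nat)) : uniq L ->
  (forall h, h \in L -> [/\ attachment_seq h.1, attachment_seq h.2,
                            size h.1 = k & size h.2 = k]) ->
  P (\bigcup_(h in [set` L]) history_event k h) =
  (((size L)%:R / (k`!%:R * k`!%:R) : R)%:E).
Proof.
move=> L_uniq L_ok; rewrite measure_fin_bigcup //.
- rewrite -fsbig_seq // big_seq.
  rewrite (eq_bigr (fun=> ((k`!%:R ^-1 * k`!%:R ^-1 : R)%:E))).
    rewrite -big_seq sumEFin big_const_seq iter_addr_0 count_predT invfM.
    by rewrite [in RHS]mulr_natl.
  move=> [h1 h2] /L_ok [] /=; exact: prob_history_event.
- exact: finite_seq.
- by move=> [h1 h2] [h1' h2'] _ _ [w [[/= <- <-] [/= <- <-]]].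
- by move=> h _; apply: measurable_history_event.
Qed.

(** There are only countably many histories. *)
Lemma measurable_of_history k (A : set Omega) :
  (forall w w', history false k w = history false k w' ->
                history true k w = history true k w' -> A w -> A w') ->
  measurable A.
Proof.
move=> A_hist.
rewrite (_ : A = \bigcup_(h in [set h | history_event k h `<=` A])
   history_event k h); last first.
  apply/seteqP; split=> [w Aw|w [h /= hA]]; last exact: hA.
  exists (history false k w, history true k w) => // w' [/= E1 E2].
  exact: A_hist Aw.
rewrite bigcup_mkcond; apply: countable_bigcupT_measurable => // h.
by case: ifP => // _; apply: measurable_history_event.
Qed.

Lemma common_subtree_size_history n w :
  common_subtree_size c n w =
  largest_common_subtree
    (attachment_tree (choices_of (history false n.-1 w)) n.-1)
    (attachment_tree (choices_of (history true n.-1 w)) n.-1).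
Proof.
have E b : attachment_tree (fun k => c b k w) n.-1 =
    attachment_tree (choices_of (history b n.-1 w)) n.-1.
  apply: eq_attachment_tree => j ltj; apply: val_inj.
  by rewrite /choices_of nth_mkseq //= inordK.
by rewrite /common_subtree_size !E.
Qed.

End History.

(** * Small common subtrees *)

Theorem theorem1p3 (R : realType) (d : measure_display)
    (Omega : measurableType d) (P : probability Omega R)
    (c : bool -> forall k : nat, Omega -> 'I_k.+1)
    (hc : independent_uniform_choices P c) (eps : R) (eps_gt0 : 0 < eps) :
  exists2 delta : R, 0 < delta &
    \forall n \near \oo,
      (delta%:E <=
       P [set w | ((common_subtree_size c n w)%:R <= eps * n%:R)%R])%E.
Proof.
pose K := (Num.truncn (3 / eps)).+1.
have K_big : 3 <= eps * K%:R.
  by rewrite mulrC -ler_pdivrMr // ltW // truncnS_gt.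
(* The star and the path have M vertices, that is, m0 attachment choices. *)
pose m0 := (4 * (K * K))%N; pose M := m0.+1.
(* In each tree, the initial shape has probability 1 / m0! and the balance of
   the blocks at least one half given that shape. *)
exists ((4 * (m0`!%:R * m0`!%:R)) ^-1).
  by rewrite invr_gt0 !mulr_gt0 // ltr0n fact_gt0.
exists M => // n /= le_Mn.
pose m := (n - M)%N; pose D := (n %/ K)%N.
have def_n : n = (m0 + m).+1 by rewrite /m /M in le_Mn *; lia.
have D_small : (3 * D)%:R <= eps * n%:R.
  rewrite natrM; apply: le_trans (ler_wpM2r (ler0n _ _) K_big) _.
  by rewrite -mulrA -natrM ler_pM2l // ler_nat mulnC leq_trunc_div.
have D_big : (4 * ((M + m) * (M + m).+1) <= M.+1 * (D.+1 * D.+1))%N.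
  have -> : (M + m)%N = n by rewrite def_n.
  (* M.+1 exceeds 4 K ^ 2, and both n and n.+1 are at most K (D + 1). *)
  have := ltn_ceil n (isT : 0 < K)%N; rewrite -/D /M /m0 => ltn.
  apply: leq_trans (_ : 4 * ((D.+1 * K) * (D.+1 * K)) <= _)%N; last by lia.
  by rewrite leq_mul2l leq_mul // ltnW.
clearbody D m m0; clear K_big K.
have half := many_balanced (ltn0Sn m0) D_big.
have size_ext := size_extensions m0 m.
set exts := extensions _ _ in half size_ext; set cnt := count _ _ in half.
pose star := nseq m0 0%N; pose path := iota 0 m0.
have star_ok : attachment_seq star by move=> j _; rewrite nth_nseq if_same.
have path_ok : attachment_seq path.
  by move=> j; rewrite size_iota => lt_j; rewrite nth_iota.
have sz_star : size star = m0 by rewrite size_nseq.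
have sz_path : size path = m0 by rewrite size_iota.
pose good := [seq t <- exts | balanced M D t].
pose L := [seq (star ++ t1, path ++ t2) | t1 <- good, t2 <- good].
have goodP t : t \in good -> [/\ t \in exts, balanced M D t & size t = m].
  by rewrite mem_filter => /andP[bal /[dup] ext /extensionsP []].
have L_uniq : uniq L.
  apply: allpairs_uniq; do ?by rewrite filter_uniq ?extensions_uniq.
  move=> [t1 t2] [t1' t2'] _ _ /= [].
  by do 2 (move/eqP; rewrite eqseq_cat // eqxx /= => /eqP ->).
have L_ok h : h \in L -> [/\ attachment_seq h.1, attachment_seq h.2,
    size h.1 = n.-1 & size h.2 = n.-1].
  case/allpairsP => -[t1 t2] [/= /goodP [ext1 _ sz1] /goodP [ext2 _ sz2] ->].
  split; rewrite /= ?size_cat ?sz_star ?sz_path ?sz1 ?sz2 ?def_n //.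
    by apply: attachment_seq_cat (m) star_ok _; rewrite sz_star.
  by apply: attachment_seq_cat (m) path_ok _; rewrite sz_path.
apply: (@le_trans _ _ (P (\bigcup_(h in [set` L]) history_event c n.-1 h))); last first.
  apply: le_measure; rewrite ?inE.
  - apply: fin_bigcup_measurable => // h _; exact: (measurable_history_event hc).
  - apply: (measurable_of_history hc (k := n.-1)) => w w' E1 E2 /=.
    by rewrite !common_subtree_size_history E1 E2.
  move=> w [h /= /allpairsP [[t1 t2] [/= /goodP [ext1 bal1 sz1]
    /goodP [ext2 bal2 sz2] ->]]] [/= E1 E2].
  apply: le_trans D_small; rewrite ler_nat common_subtree_size_history E1 E2.
  apply: star_path_largest_common_subtree => //.
  + by apply: attachment_seq_cat (m) star_ok _; rewrite sz_star.
  + by apply: attachment_seq_cat (m) path_ok _; rewrite sz_path.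
  + by rewrite size_cat size_nseq sz1 def_n.
  + by rewrite size_cat size_iota sz2 def_n.
rewrite (prob_history_events hc L_uniq L_ok) lee_fin size_allpairs size_filter -/cnt.
have -> : n.-1 = (m0 + m)%N by rewrite def_n.
rewrite -size_ext -/exts.
have m0_gt0 : 0 < (m0`!)%:R :> R by rewrite ltr0n fact_gt0.
have exts_gt0 : 0 < (size exts)%:R :> R.
  have := fact_gt0 (m0 + m); rewrite -size_ext muln_gt0 => /andP[_].
  by rewrite ltr0n.
have half' : (size exts)%:R <= 2 * cnt%:R :> R by rewrite -natrM ler_nat.
rewrite ler_pdivlMr ?mulr_gt0 // ?natrM ?mulr_gt0 //.
rewrite mulrC ler_pdivrMr ?mulr_gt0 //.
set a := m0`!%:R in m0_gt0 *; set x := (size exts)%:R in exts_gt0 half' *.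
set y := cnt%:R in half' *.
have xx : x * x <= (2 * y) * (2 * y) by apply: ler_pM => //; apply: ltW.
have -> : a * x * (a * x) = a * a * (x * x) by rewrite mulrACA.
have -> : y * y * (4 * (a * a)) = a * a * ((2 * y) * (2 * y)) by ring.
by rewrite ler_pM2l ?mulr_gt0.
Qed.
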